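(* Let $C_n$ denote the cycle on $n\ge 3$ vertices. Then $c_k(C_n)=n$ for every integer $k\ge 3$.
   Context: All graphs are finite and simple. Let $G$ be a graph and $k\ge 2$ an integer. A multiset $\mathscr{P}$ of paths in $G$ is a $k$-rainbow separating path system ($k$-RSPS) if its elements can be colored with (at most) $k$ colors so that for every pair of distinct edges $e_1,e_2\in E(G)$ there exist paths $P_1,P_2\in\mathscr{P}$ of distinct colors such that $P_1$ contains $e_1$ but not $e_2$, and $P_2$ contains $e_2$ but not $e_1$. The $k$-rainbow separation number $c_k(G)$ is the smallest cardinality (with multiplicity) of a $k$-RSPS of $G$. *)

(* Defs.v *)
From mathcomp Require Import all_boot.
From mathcomp Require Import boolp.

Set Implicit Arguments.
Unset Strict Implicit.
Unset Printing Implicit Defensive.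

Record sgraph := SGraph {
  svertex :> finType;
  sadj : rel svertex;
  sadj_sym : symmetric sadj;
  sadj_irr : irreflexive sadj }.

Definition edges (G : sgraph) : {set {set G}} :=
  [set [set z.1; z.2] | z : G * G & sadj z.1 z.2].

(* A path is given by one of its vertex sequences [x :: s]; the two sequences
   (a sequence and its reversal) describing the same subgraph have the same
   edges, so this choice does not affect cardinalities of path systems. *)
Record gpath (G : sgraph) := GPath {
  phead : G;
  ptail : seq G;
  ppath : path (@sadj G) phead ptail;
  puniq : uniq (phead :: ptail) }.

Definition path_edges (G : sgraph) (p : gpath G) : seq {set G} :=
  pairmap (fun x y => [set x; y]) (phead p) (ptail p).

(* A multiset of paths is a list; the colour is attached to positions, so that
   repeated copies of one path may get different colours. *)
Definition rainbow_separating (G : sgraph) (k : nat) (P : seq (gpath G)) : Prop :=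
  exists col : 'I_(size P) -> 'I_k,
    forall e1 e2 : {set G}, e1 \in edges G -> e2 \in edges G -> e1 != e2 ->
      exists i j : 'I_(size P),
        let P1 := tnth (in_tuple P) i in
        let P2 := tnth (in_tuple P) j in
        [/\ col i != col j,
            (e1 \in path_edges P1) && (e2 \notin path_edges P1) &
            (e2 \in path_edges P2) && (e1 \notin path_edges P2)].

Definition has_rsps (G : sgraph) (k m : nat) : Prop :=
  exists2 P : seq (gpath G), size P = m & rainbow_separating k P.

Lemma has_rsps_ge2 (G : sgraph) (k : nat) : 1 < k -> exists m, has_rsps G k m.
Proof.
move=> k1.
pose T := {z : G * G | sadj z.1 z.2}.
have pT (z : T) : path (@sadj G) (val z).1 [:: (val z).2].
  by rewrite /= (valP z).
have uT (z : T) : uniq [:: (val z).1; (val z).2].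
  rewrite /= inE andbT; apply/eqP => eqz.
  by have := valP z; rewrite eqz sadj_irr.
pose f z := GPath (pT z) (uT z).
pose S := [seq f z.1 | z <- enum ({: T * bool})].
have szS : size S = #|{: T * bool}| by rewrite size_map cardE.
pose k0 : 'I_k := Ordinal (ltnW k1).
pose k1' : 'I_k := Ordinal k1.
pose col (i : 'I_(size S)) := if (enum_val (cast_ord szS i)).2 then k1' else k0.
exists (size S), S => //; exists col => e1 e2.
move=> /imsetP[z1]; rewrite inE => z1E e1E.
move=> /imsetP[z2]; rewrite inE => z2E e2E e12.
have E (z : G * G) (hz : sadj z.1 z.2) (b : bool) : exists i : 'I_(size S),
    col i = (if b then k1' else k0)
    /\ path_edges (tnth (in_tuple S) i) = [:: [set z.1; z.2]].
  pose w : T := exist _ z hz.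
  exists (cast_ord (esym szS) (enum_rank (w, b))); split.
    by rewrite /col cast_ordKV enum_rankK.
  rewrite (tnth_nth (f w)) /= (nth_map (w, b)) -?cardE ?ltn_ord //.
  by rewrite nth_enum_rank.
have [i [ci Ei]] := E z1 z1E false.
have [j [cj Ej]] := E z2 z2E true.
exists i, j => /=; rewrite Ei Ej ci cj; split => //.
- by rewrite !inE e1E e2E eqxx /= -e1E -e2E eq_sym.
- by rewrite !inE e1E e2E eqxx /= -e1E -e2E.
Qed.

Lemma has_rsps_asbool (G : sgraph) (k : nat) :
  (exists m, has_rsps G k m) -> exists m, `[< has_rsps G k m >].
Proof. by move=> [m hm]; exists m; apply/asboolP. Qed.

(* The least size of a k-RSPS of G. One exists for every k >= 2 by
   [has_rsps_ge2]; the default value 0 can only occur for k < 2. *)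
Definition rainbow_separation_number (k : nat) (G : sgraph) : nat :=
  if pselect (exists m, has_rsps G k m) is left h
  then ex_minn (has_rsps_asbool h) else 0.

Lemma rainbow_separation_numberP (k : nat) (G : sgraph) : 1 < k ->
  has_rsps G k (rainbow_separation_number k G) /\
  forall m, has_rsps G k m -> rainbow_separation_number k G <= m.
Proof.
move=> k1; rewrite /rainbow_separation_number.
case: pselect => [h|]; last by have := has_rsps_ge2 G k1.
case: ex_minnP => m /asboolP hm minm; split=> // m' /asboolP; exact: minm.
Qed.

(* [ordS] is the cyclic successor i |-> i + 1 mod n; the conjunct [x != y] only
   matters for n = 1, and the graph is the usual cycle when n >= 3. *)
Definition cycle_adj (n : nat) : rel 'I_n :=
  [rel x y | (x != y) && ((ordS x == y) || (ordS y == x))].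

Lemma cycle_adj_sym (n : nat) : symmetric (@cycle_adj n).
Proof. by move=> x y; rewrite /cycle_adj /= eq_sym orbC. Qed.

Lemma cycle_adj_irr (n : nat) : irreflexive (@cycle_adj n).
Proof. by move=> x; rewrite /cycle_adj /= eqxx. Qed.

Definition cycle_graph (n : nat) : sgraph :=
  SGraph (@cycle_adj_sym n) (@cycle_adj_irr n).

(* Main.v *)
Require Import Defs.
From mathcomp Require Import all_boot.
From mathcomp Require Import zify.

(** Write e_i for the edge from i to i + 1 of the cycle.

    Lower bound. Separating e_i from e_(i+1) takes a path that contains e_i and
    avoids e_(i+1). A path serves at most one i in this way
    ([path_end_unique]): its vertices include the starting point of each of
    its edges, and also i + 1 for each i served, but a path has only one more
    vertex than it has edges. Hence there are at least n paths, whatever the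
    number of colours ([cycle_rsps_lower]).

    Upper bound. Take the n paths P_i with edges e_i and e_(i+1). The edges e_i
    and e_(i+1) are separated only by P_(i-1) and P_(i+1), so these two need
    different colours. Non-adjacent edges e_i and e_j are separated by either
    of P_(i-1), P_i together with either of P_(j-1), P_j, which fails only if
    all four have the same colour. So it suffices to colour the indices with
    three colours such that positions at distance two differ, and such that
    each colour is repeated at most once on consecutive positions. The word
    012012... does this, except when n = 2 modulo 3, where its last two letters
    0, 1 are replaced by 2, 0 ([arc_color]). *)

(** * Edges of paths and of cycles *)

Lemma path_edge_sub (T : finType) (x : T) (s : seq T) (e : {set T}) :
  e \in pairmap (fun x y => [set x; y]) x s -> {subset e <= x :: s}.
Proof.
elim: s x => [|y s IHs] x //=; rewrite inE => /orP[/eqP -> z|/IHs es z /es zs].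
  by rewrite !inE => /orP[/eqP ->|/eqP ->]; rewrite eqxx ?orbT.
by rewrite inE zs orbT.
Qed.

Lemma path_edges_uniq (T : finType) (x : T) (s : seq T) :
  uniq (x :: s) -> uniq (pairmap (fun x y => [set x; y]) x s).
Proof.
elim: s x => [|y s IHs] x //= /andP[xNs us]; rewrite IHs // andbT.
apply: contra xNs => /path_edge_sub; apply; exact: set21.
Qed.

Lemma path_edges_edge (G : sgraph) (p : gpath G) e :
  e \in path_edges p -> e \in edges G.
Proof.
rewrite /path_edges; case: p => x s /= pxs _.
elim: s x pxs => [|y s IHs] x //= /andP[xy pys].
rewrite inE => /orP[/eqP ->|]; last exact: IHs.
by apply/imsetP; exists (x, y); rewrite ?inE.
Qed.

Definition cycle_edge (n : nat) (i : cycle_graph n) : {set cycle_graph n} :=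
  [set i; (ordS i : cycle_graph n)].

Lemma ordSP (n : nat) (i : 'I_n) :
  (i.+1 = n /\ ordS i = 0 :> nat) \/ (i.+1 < n /\ ordS i = i.+1 :> nat).
Proof.
rewrite /=; have:= ltn_ord i; rewrite leq_eqVlt => /orP[/eqP iSn|iSn].
  by left; split; rewrite // iSn modnn.
by right; rewrite modn_small.
Qed.

Lemma ordS_neq (n : nat) (i : 'I_n) : 1 < n -> ordS i != i.
Proof.
move=> n1; apply/eqP => /(congr1 (@nat_of_ord n)).
by have [[? ->]|[? ->]] := ordSP n i; lia.
Qed.

Lemma ordSS_neq (n : nat) (i : 'I_n) : 2 < n -> ordS (ordS i) != i.
Proof.
move=> n2; apply/eqP => /(congr1 (@nat_of_ord n)).
by have [[? ->]|[? ->]] := ordSP n (ordS i); have := ordSP n i; lia.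
Qed.

(** Two edges coincide with i <> j only if each of i, j follows the other,
    which a cycle of length at least 3 excludes. *)
Lemma cycle_edge_inj (n : nat) : 2 < n -> injective (cycle_edge n).
Proof.
move=> n2 i j /setP eij.
have:= eij i; rewrite !inE eqxx => /esym/orP[/eqP //|/eqP iSj].
have:= eij j; rewrite !inE eqxx => /orP[/eqP -> //|/eqP jSi].
by have := ordSS_neq n i n2; rewrite -jSi -iSj eqxx.
Qed.

Lemma sadj_ordS (n : nat) (i : cycle_graph n) :
  1 < n -> @sadj (cycle_graph n) i (ordS i).
Proof. by move=> n1; apply/andP; rewrite eq_sym ordS_neq // eqxx. Qed.

Lemma cycle_edge_in (n : nat) (i : cycle_graph n) :
  1 < n -> cycle_edge n i \in edges (cycle_graph n).
Proof.
move=> n1; apply/imsetP; exists (i, ordS i : cycle_graph n) => //.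
by rewrite inE sadj_ordS.
Qed.

Lemma edges_cycleP (n : nat) (e : {set cycle_graph n}) :
  e \in edges (cycle_graph n) -> exists i, e = cycle_edge n i.
Proof.
case/imsetP=> [[x y]]; rewrite inE /= => /andP[_ /orP[]] /eqP <- ->.
  by exists x.
by exists y; rewrite /cycle_edge setUC.
Qed.

Definition contains_avoids (n : nat) (p : gpath (cycle_graph n))
    (i j : cycle_graph n) : bool :=
  (cycle_edge n i \in path_edges p) && (cycle_edge n j \notin path_edges p).

(** * Every path system has at least n paths *)

(** With A the set of indices of the edges of p, the set A together with i + 1
    and j + 1 consists of vertices of p, which number #|A| + 1; and i + 1,
    j + 1 are outside A. *)
Lemma path_end_unique (n : nat) (p : gpath (cycle_graph n))
    (i j : cycle_graph n) : 2 < n ->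
  contains_avoids n p i (ordS i) -> contains_avoids n p j (ordS j) -> i = j.
Proof.
move=> n2 /andP[pi pSi] /andP[pj pSj]; apply/eqP/negPn/negP => iNj.
pose A := [set l | cycle_edge n l \in path_edges p].
have cardA : #|A| = size (ptail p).
  rewrite -(card_imset _ (cycle_edge_inj n n2)).
  rewrite -(size_pairmap (fun x y => [set x; y]) (phead p)).
  rewrite -(card_uniqP (path_edges_uniq _ _ _ (puniq p))).
  apply: eq_card => e; apply/imsetP/idP => [[l]|pe]; first by rewrite inE => ? ->.
  have [l el] := edges_cycleP n e (path_edges_edge _ _ _ pe).
  by exists l => //; rewrite inE -el.
pose B := (ordS i : cycle_graph n) |: ((ordS j : cycle_graph n) |: A).
have cardB : #|B| = (size (ptail p)).+2.
  by rewrite /B !cardsU1 cardA !inE (negbTE pSi) pSj (inj_eq (@ordS_inj n)) (negbTE iNj).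
have sub l : cycle_edge n l \in path_edges p ->
    (l \in phead p :: ptail p) /\ (ordS l \in phead p :: ptail p).
  by move=> /path_edge_sub pl; split; apply: pl; rewrite !inE eqxx ?orbT.
have: #|B| <= size (phead p :: ptail p).
  rewrite -(card_uniqP (puniq p)); apply/subset_leq_card/subsetP => l.
  rewrite !in_setU1 => /or3P[/eqP ->|/eqP ->|].
  - exact: (sub i pi).2.
  - exact: (sub j pj).2.
  - by rewrite inE => /sub[].
by rewrite cardB /= ltnn.
Qed.

Lemma cycle_rsps_lower (n k m : nat) :
  2 < n -> has_rsps (cycle_graph n) k m -> n <= m.
Proof.
move=> n2 [P <- [col sepP]].
have n1 : 1 < n := ltnW n2.
have end_at (i : 'I_n) : {l : 'I_(size P) |
    contains_avoids n (tnth (in_tuple P) l) i (ordS i)}.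
  apply/sigW.
  have neq : cycle_edge n i != cycle_edge n (ordS i).
    by rewrite (inj_eq (cycle_edge_inj n n2)) eq_sym ordS_neq.
  have [l [_ [_ sep _]]] := sepP _ _ (cycle_edge_in n i n1)
                                     (cycle_edge_in n (ordS i) n1) neq.
  by exists l.
have f_inj : injective (fun i => sval (end_at i)).
  move=> i j /= eq_ij.
  have := svalP (end_at j); rewrite -eq_ij.
  by apply: path_end_unique => //; exact: svalP (end_at i).
by have := leq_card _ f_inj; rewrite !card_ord.
Qed.

(** * Three colours suffice for n paths with two edges each *)

Definition arc_color (n i : nat) : nat :=
  (if (n %% 3 == 2) && (n <= i.+2) then i.+2 else i) %% 3.

Lemma arc_color_lt3 (n i : nat) : arc_color n i < 3.
Proof. exact: ltn_pmod. Qed.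

Lemma arc_color_neq2 (n : nat) (i : 'I_n) :
  2 < n -> arc_color n i != arc_color n (ordS (ordS i)).
Proof.
move=> n2; rewrite /arc_color.
have := ordSP n i; have := ordSP n (ordS i).
by do ?[case: ifP => ?]; lia.
Qed.

(** The only repetitions are the colour 0 at the positions n - 1 and 0, when n
    is not divisible by 3, and the colour 2 at the positions n - 3 and n - 2,
    when n = 2 modulo 3. *)
Lemma arc_color_repeat_unique (n : nat) (i j : 'I_n) : 2 < n ->
  arc_color n i = arc_color n (ordS i) ->
  arc_color n j = arc_color n (ordS j) ->
  arc_color n i = arc_color n j -> i = j.
Proof.
move=> n2; rewrite /arc_color => ri rj cij; apply: ord_inj.
have := ordSP n i; have := ordSP n j; move: ri rj cij.
by do ?[case: ifP => ?]; lia.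
Qed.

Section Arcs.

Variables (n : nat) (n2 : 2 < n).
Implicit Types i j : cycle_graph n.

Let n1 : 1 < n := ltnW n2.

Lemma arc_path i :
  path (@sadj (cycle_graph n)) i [:: ordS i; ordS (ordS i)].
Proof. by apply/and3P; rewrite !sadj_ordS. Qed.

Lemma arc_uniq i : uniq [:: i; (ordS i : cycle_graph n); ordS (ordS i)].
Proof.
have Sneq (x : 'I_n) : x != ordS x by rewrite eq_sym ordS_neq.
by rewrite !cons_uniq !inE negb_or !Sneq eq_sym ordSS_neq.
Qed.

Definition arc i : gpath (cycle_graph n) := GPath (arc_path i) (arc_uniq i).

Lemma mem_arc i j :
  (cycle_edge n j \in path_edges (arc i)) = (j == i) || (j == ordS i).
Proof.
by rewrite /path_edges /= !inE -!/(cycle_edge n _) !(inj_eq (cycle_edge_inj n n2)).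
Qed.

(** For adjacent edges the two arcs are forced, and start at positions that are
    two apart. For other edges, u may be i - 1 or i and v may be j - 1 or j
    independently, so a failure would give two repetitions of one colour. *)
Lemma arcs_separate i j : i != j -> exists u v : 'I_n,
  [/\ arc_color n u != arc_color n v,
      contains_avoids n (arc u) i j & contains_avoids n (arc v) j i].
Proof.
have adjacent x : exists u v : 'I_n, [/\ arc_color n u != arc_color n v,
    contains_avoids n (arc u) x (ordS x) & contains_avoids n (arc v) (ordS x) x].
  rewrite -[x]ord_predK; set y : 'I_n := ord_pred x; exists y, (ordS (ordS y)).
  rewrite arc_color_neq2 // /contains_avoids !mem_arc !eqxx orbT !negb_or.
  rewrite ![ordS y == ordS _]eq_sym !ordSS_neq //.
  by rewrite !ordS_neq.
move=> iNj.
case: (eqVneq j (ordS i)) => [->|jNSi]; first exact: adjacent.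
case: (eqVneq i (ordS j)) => [->|iNSj].
  by have [u [v [cuv su sv]]] := adjacent j; exists v, u; rewrite eq_sym.
have either x y u : x != y -> y != ordS x -> x != ordS y ->
    u \in [:: x; (ord_pred x : cycle_graph n)] -> contains_avoids n (arc u) x y.
  move=> xNy yNSx xNSy; rewrite !inE /contains_avoids !mem_arc negb_or.
  case/orP=> /eqP ->; rewrite ?ord_predK eqxx ?orbT /= [y == x]eq_sym xNy //.
  by rewrite andbT -(inj_eq (@ordS_inj n)) ord_predK eq_sym.
have pick_colors u v : u \in [:: i; (ord_pred i : cycle_graph n)] ->
    v \in [:: j; (ord_pred j : cycle_graph n)] ->
    arc_color n u != arc_color n v -> exists u' v' : 'I_n,
  [/\ arc_color n u' != arc_color n v',
      contains_avoids n (arc u') i j & contains_avoids n (arc v') j i].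
  by move=> ui vj cuv; exists u, v; split=> //; apply: either; rewrite // eq_sym.
case: (eqVneq (arc_color n i) (arc_color n j)) => [cij|]; last first.
  by apply: pick_colors; rewrite !inE eqxx.
case: (eqVneq (arc_color n (ord_pred i)) (arc_color n j)) => [cpij|]; last first.
  by apply: pick_colors; rewrite !inE eqxx ?orbT.
case: (eqVneq (arc_color n i) (arc_color n (ord_pred j))) => [cipj|]; last first.
  by apply: pick_colors; rewrite !inE eqxx ?orbT.
(* All four arcs have the same colour, so i - 1 and j - 1 are the same repetition. *)
case/negP: iNj; rewrite -(inj_eq (@ord_pred_inj n)); apply/eqP.
by apply: arc_color_repeat_unique; rewrite ?ord_predK //; congruence.
Qed.

End Arcs.

Lemma cycle_rsps_upper (n k : nat) :
  2 < n -> 2 < k -> has_rsps (cycle_graph n) k n.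
Proof.
move=> n2 k2; pose P := [tuple arc n n2 i | i < n].
have szP : n = size P by rewrite size_tuple.
exists P => //.
exists (fun l => Ordinal (leq_trans (arc_color_lt3 n l) k2)) => e1 e2.
move=> /edges_cycleP[i ->] /edges_cycleP[j ->] ij.
have iNj : i != j by apply: contra ij => /eqP ->.
have [u [v [cuv su sv]]] := arcs_separate n n2 i j iNj.
have tnthP w : tnth (in_tuple P) (cast_ord szP w) = arc n n2 w.
  by rewrite -[RHS](tnth_mktuple (arc n n2)) !(tnth_nth (arc n n2 w)).
by exists (cast_ord szP u), (cast_ord szP v); rewrite /= !tnthP.
Qed.

(** * The rainbow separation number of a cycle *)

Theorem theorem3p2 (n k : nat) (hn : 3 <= n) (hk : 3 <= k) :
  rainbow_separation_number k (cycle_graph n) = n.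
Proof.
have [hc min_c] := rainbow_separation_numberP (cycle_graph n) (ltnW hk).
apply/eqP; rewrite eqn_leq min_c; last exact: cycle_rsps_upper.
exact: cycle_rsps_lower hc.
Qed.
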